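(* Let $C_1,\ldots,C_n$ be a finite ordered family of pairwise disjoint compact convex sets in $\mathbb{R}^2$, each colored red, green or blue. For each $i$ let $f_{C_i}:\mathcal{C}(\mathbb{R}^2)\to\mathbb{R}$ be a monotone function, continuous with respect to the Hausdorff metric, and let $\alpha_{C_i}\in\mathbb{R}$; write $f=(f_{C_i})_i$, $\alpha=(\alpha_{C_i})_i$. Suppose that for every choice of indices $i<j<k$ such that $C_i,C_j,C_k$ have three different colors, there is a directed line which is an $(f,\alpha)$-transversal of $C_i,C_j,C_k$ and meets them in the order $C_i,C_j,C_k$ along its direction. Then there is a color such that some directed line is an $(f,\alpha)$-transversal of all the sets $C_i$ of that color.
   Context: $\mathcal{C}(\mathbb{R}^2)$ denotes the family of convex subsets of $\mathbb{R}^2$. A function $g:\mathcal{C}(\mathbb{R}^2)\to\mathbb{R}$ is monotone if for all convex $K_1\subset K_2$ one has $g(K_1)\le g(K_2)$ (or always $g(K_1)\ge g(K_2)$). For a directed line $\ell$ and a convex set $C$, $\ell^+(C)$ is the intersection of $C$ with the closed half-plane bounded by $\ell$ to the left of the direction of $\ell$, and $\ell^-(C)$ is the intersection of $C$ with the opposite closed half-plane. A directed line $\ell$ is an $(f,\alpha)$-stabber of $C_i$ if $f_{C_i}(\ell^+(C_i))\ge\alpha_{C_i}$ and $f_{C_i}(\ell^-(C_i))\ge\alpha_{C_i}$; it is an $(f,\alpha)$-transversal of a subfamily if it is an $(f,\alpha)$-stabber of each set of the subfamily. *)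

(* Defs.v *)
(* The plane is 'rV[R]_2, for R : realType. *)
From HB Require Import structures.
From mathcomp Require Export all_boot all_order all_algebra.
From mathcomp Require Export all_classical all_reals all_analysis.
Export numFieldNormedType.Exports.
From mathcomp Require Import ring.
Import Order.TTheory GRing.Theory Num.Theory.

Set Implicit Arguments.
Unset Strict Implicit.
Unset Printing Implicit Defensive.

Local Open Scope classical_set_scope.
Local Open Scope ring_scope.

Inductive color := red | green | blue.

(* All convex subsets of the plane, the empty set and unbounded or non-closed
   sets included. *)
Record convexSet (R : realType) := ConvexSet {
  cset :> set 'rV[R]_2;
  cset_convex : convex_set cset }.

(* The norm the library puts on 'rV[R]_2 is the sup norm, hence this definition
   of the Euclidean distance. *)
Definition eucl_dist (R : realType) (x y : 'rV[R]_2) : R :=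
  Num.sqrt (\sum_(i < 2) (x 0 i - y 0 i) ^+ 2).

(* Extended-real valued, as the sets may be unbounded or empty: in particular
   the empty set is at distance +oo from every nonempty set. *)
Definition hausdorff_dist (R : realType) (A B : set 'rV[R]_2) : \bar R :=
  ereal_inf [set r%:E | r in [set r : R | [/\ 0 <= r,
    forall x, A x -> exists2 y, B y & eucl_dist x y <= r &
    forall y, B y -> exists2 x, A x & eucl_dist x y <= r]]].

Definition monotone_cfun (R : realType) (g : convexSet R -> R) : Prop :=
  (forall K1 K2 : convexSet R, K1 `<=` K2 -> g K1 <= g K2) \/
  (forall K1 K2 : convexSet R, K1 `<=` K2 -> g K2 <= g K1).

Definition hausdorff_continuous (R : realType) (g : convexSet R -> R) : Prop :=
  forall (K : convexSet R) (e : R), 0 < e ->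
  exists2 d : R, 0 < d & forall K' : convexSet R,
    (hausdorff_dist K K' < d%:E)%E -> `|g K - g K'| < e.

Record directed_line (R : realType) := DirectedLine {
  line_base : 'rV[R]_2;
  line_dir : 'rV[R]_2;
  line_dir_neq0 : line_dir != 0 }.

Definition line_point (R : realType) (l : directed_line R) (t : R) : 'rV[R]_2 :=
  line_base l + t *: line_dir l.

(* The determinant of (direction of l, x - base point of l): it is positive
   exactly when x lies strictly to the left of l. *)
Definition line_side (R : realType) (l : directed_line R) (x : 'rV[R]_2) : R :=
  line_dir l 0 0 * (x - line_base l) 0 1 -
  line_dir l 0 1 * (x - line_base l) 0 0.

Lemma line_side_conv (R : realType) (l : directed_line R) (x y : 'rV[R]_2)
    (t : R) :
  line_side l (t *: x + (1 - t) *: y) =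
  t * line_side l x + (1 - t) * line_side l y.
Proof. by rewrite /line_side !mxE; ring. Qed.

Lemma convex_left (R : realType) (l : directed_line R) (C : convexSet R) :
  convex_set (C `&` [set x | 0 <= line_side l x]).
Proof.
move=> x y t; rewrite !inE => -[Cx lx] [Cy ly]; split.
  by have := @cset_convex R C x y t; rewrite !inE; apply.
by rewrite /= /conv /= line_side_conv addr_ge0 ?mulr_ge0 //.
Qed.

Lemma convex_right (R : realType) (l : directed_line R) (C : convexSet R) :
  convex_set (C `&` [set x | line_side l x <= 0]).
Proof.
move=> x y t; rewrite !inE => -[Cx lx] [Cy ly]; split.
  by have := @cset_convex R C x y t; rewrite !inE; apply.
rewrite /= /conv /= line_side_conv -oppr_ge0 opprD -!mulrN.
by rewrite addr_ge0 ?mulr_ge0 ?oppr_ge0.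
Qed.

(* l^+(C) and l^-(C) *)
Definition left_part (R : realType) (l : directed_line R) (C : convexSet R) :
  convexSet R := ConvexSet (@convex_left R l C).

Definition right_part (R : realType) (l : directed_line R) (C : convexSet R) :
  convexSet R := ConvexSet (@convex_right R l C).

Definition stabber (R : realType) (f : convexSet R -> R) (alpha : R)
    (l : directed_line R) (C : convexSet R) : Prop :=
  alpha <= f (left_part l C) /\ alpha <= f (right_part l C).

Definition transversal (R : realType) (n : nat) (f : 'I_n -> convexSet R -> R)
    (alpha : 'I_n -> R) (l : directed_line R) (C : 'I_n -> convexSet R)
    (S : set 'I_n) : Prop :=
  forall i, S i -> stabber (f i) (alpha i) l (C i).

Definition meets (R : realType) (l : directed_line R) (A : set 'rV[R]_2) : Prop :=
  exists t, A (line_point l t).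

Definition precedes (R : realType) (l : directed_line R) (A B : set 'rV[R]_2)
  : Prop :=
  forall s t, A (line_point l s) -> B (line_point l t) -> s < t.

Definition meets_in_order (R : realType) (l : directed_line R)
    (A B C : set 'rV[R]_2) : Prop :=
  [/\ meets l A, meets l B, meets l C, precedes l A B & precedes l B C].

(* Main.v *)
(* Choose a transversal m for each rainbow triple i < j < k. If a line l does
   not stab C_x, monotonicity forces every stabber m of C_x to have a point of C_x on
   one and the same side of l; so x gets a sign, + (left) or - (right). Since m
   meets C_i, C_j, C_k in this order and crosses l at most once, a rainbow triple
   never has signs + - + or - + -. Only the finitely many lines m matter, so the
   signs can be relaxed to open conditions on l.

   Suppose no color has a transversal. Sweep a line of fixed direction from right
   to left: each color must switch from + to -, at some offset s_c where an index
   i_c is + and an index j_c is -. Non-alternation forces either j_a < i_b for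
   all colors a, b with s_a <= s_b, or j_a > i_b for all of them, and which case
   occurs depends on the direction only. Both cases are open in the direction
   and are exchanged by reversing it, contradicting the connectedness of the
   line of angles. *)
Require Import Defs.
From mathcomp Require Import ring lra zify.
Import Order.TTheory GRing.Theory Num.Theory.
Set Implicit Arguments.
Unset Strict Implicit.
Unset Printing Implicit Defensive.
Local Open Scope classical_set_scope.
Local Open Scope ring_scope.

(** * Lines, convex sets and stabbers *)

Section plane.
Variable R : realType.
Implicit Types (m l : directed_line R) (C X Y : convexSet R) (x y : 'rV[R]_2).

Lemma eq_row2 x y : x 0 0 = y 0 0 -> x 0 1 = y 0 1 -> x = y.
Proof.
move=> e0 e1; apply/rowP => -[[|[|//]] h].
  by rewrite (_ : Ordinal h = 0) //; exact: val_inj.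
by rewrite (_ : Ordinal h = 1) //; exact: val_inj.
Qed.

Lemma sqr_dir_gt0 m : 0 < line_dir m 0 0 ^+ 2 + line_dir m 0 1 ^+ 2.
Proof.
rewrite lt_neqAle addr_ge0 ?sqr_ge0 // andbT eq_sym paddr_eq0 ?sqr_ge0 //.
rewrite !sqrf_eq0; apply: contraNN (line_dir_neq0 m) => /andP[/eqP d0 /eqP d1].
by apply/eqP/eq_row2; rewrite mxE.
Qed.

(** The parameter on [m] of the orthogonal projection of [x]. *)
Definition line_param m x : R :=
  (line_dir m 0 0 * (x - line_base m) 0 0 +
   line_dir m 0 1 * (x - line_base m) 0 1) /
  (line_dir m 0 0 ^+ 2 + line_dir m 0 1 ^+ 2).

Lemma line_paramK m : cancel (line_point m) (line_param m).
Proof.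
move=> t; have := lt0r_neq0 (sqr_dir_gt0 m).
by rewrite /line_param /line_point !mxE => d0; field.
Qed.

Lemma line_side_point m t : line_side m (line_point m t) = 0.
Proof. by rewrite /line_side /line_point !mxE; ring. Qed.

Lemma line_side0_point m x : line_side m x = 0 ->
  line_point m (line_param m x) = x.
Proof.
have d0 := lt0r_neq0 (sqr_dir_gt0 m); rewrite /line_side !mxE => s0.
apply: eq_row2; rewrite /line_point /line_param !mxE.
  apply: (mulIf d0); apply/eqP; rewrite -subr_eq0; apply/eqP.
  transitivity (line_dir m 0 1 * (line_dir m 0 0 * (x 0 1 - line_base m 0 1) -
     line_dir m 0 1 * (x 0 0 - line_base m 0 0))); last by rewrite s0 mulr0.
  by field.
apply: (mulIf d0); apply/eqP; rewrite -subr_eq0; apply/eqP.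
transitivity (- line_dir m 0 0 * (line_dir m 0 0 * (x 0 1 - line_base m 0 1) -
     line_dir m 0 1 * (x 0 0 - line_base m 0 0))); last by rewrite s0 mulr0.
by field.
Qed.

Lemma continuous_affine2 (a b c : R) :
  continuous (fun x : 'rV[R]_2 => a * x 0 0 + b * x 0 1 + c).
Proof.
have cM (d : R) k : continuous (fun x : 'rV[R]_2 => d * x 0 k).
  move=> x; apply: (@continuousM _ _ (cst d) (fun y : 'rV[R]_2 => y 0 k)).
    exact: cst_continuous.
  exact: coord_continuous.
move=> x; apply: (@continuousD _ _ _ (fun y => a * y 0 0 + b * y 0 1) (cst c)).
  apply: (@continuousD _ _ _ (fun y => a * y 0 0) (fun y => b * y 0 1));
    exact: cM.
exact: cst_continuous.
Qed.

Lemma continuous_line_side m : continuous (line_side m).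
Proof.
pose c := line_dir m 0 1 * line_base m 0 0 - line_dir m 0 0 * line_base m 0 1.
rewrite (_ : line_side m =
  fun x => - line_dir m 0 1 * x 0 0 + line_dir m 0 0 * x 0 1 + c).
  exact: continuous_affine2.
by apply/funext => x; rewrite /line_side /c !mxE; ring.
Qed.

Lemma continuous_line_param m : continuous (line_param m).
Proof.
pose q := line_dir m 0 0 ^+ 2 + line_dir m 0 1 ^+ 2.
pose c := - (line_dir m 0 0 * line_base m 0 0 +
             line_dir m 0 1 * line_base m 0 1) / q.
rewrite (_ : line_param m =
  fun x => line_dir m 0 0 / q * x 0 0 + line_dir m 0 1 / q * x 0 1 + c).
  exact: continuous_affine2.
by apply/funext => x; rewrite /line_param /c -/q !mxE; ring.
Qed.

Lemma compact_meets_line m (A : set 'rV[R]_2) :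
  compact A -> compact (A `&` [set x | line_side m x = 0]).
Proof.
move=> cA; apply: compact_closedI => //.
have -> : [set x | line_side m x = 0] = line_side m @^-1` [set 0] by [].
apply: preimage_closed; last exact: closed_eq.
by move=> x _; exact: continuous_line_side.
Qed.

(** By compactness the last parameter of [A] on [m] and the first one of [B] are attained; [d] is
    their difference. *)
Lemma precedes_gap m (A B : set 'rV[R]_2) : compact A -> compact B ->
  meets m A -> meets m B -> precedes m A B ->
  exists2 d : R, 0 < d &
    forall s t, A (line_point m s) -> B (line_point m t) -> s + d <= t.
Proof.
move=> cA cB [s0 As0] [t0 Bt0] AB.
have [||a] := compact_EVT_max (f := line_param m) _ (@compact_meets_line m _ cA).
- by exists (line_point m s0); split=> //; exact: line_side_point.
- exact/continuous_subspaceT/continuous_line_param.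
rewrite inE => -[Aa a0] amax.
have [||b] := compact_EVT_max (f := \- line_param m) _ (@compact_meets_line m _ cB).
- by exists (line_point m t0); split=> //; exact: line_side_point.
- apply: continuous_subspaceT => x.
  by apply: continuousN; exact: continuous_line_param.
rewrite inE => -[Bb b0] bmax.
exists (line_param m b - line_param m a).
  by rewrite subr_gt0; apply: AB; rewrite line_side0_point.
move=> s t As Bt.
have := amax (line_point m s); rewrite inE line_paramK => /(_ _).
have := bmax (line_point m t); rewrite inE /= line_paramK => /(_ _).
move=> /(_ (conj Bt (line_side_point _ _))) +.
by move=> + /(_ (conj As (line_side_point _ _))); lra.
Qed.

Lemma convex_misses_line m X : (forall t, ~ cset X (line_point m t)) ->
  (forall x, cset X x -> 0 < line_side m x) \/
  (forall x, cset X x -> line_side m x < 0).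
Proof.
move=> miss; apply: contrapT => /not_orP[/existsNP[x /not_implyP[Xx sx]]].
move=> /existsNP[y /not_implyP[Xy sy]].
have ns z : cset X z -> line_side m z != 0.
  move=> Xz; apply/eqP => /line_side0_point zE.
  by apply: (miss (line_param m z)); rewrite zE.
have {}sx : line_side m x < 0.
  by rewrite lt_neqAle ns //= leNgt; apply/negP.
have {}sy : 0 < line_side m y.
  by rewrite lt_neqAle eq_sym ns //= leNgt; apply/negP.
have d0 : 0 < line_side m y - line_side m x by lra.
(* The weight at which the side function, affine on the segment, vanishes. *)
pose t := line_side m y / (line_side m y - line_side m x).
have t0 : 0 <= t by apply: divr_ge0; lra.
have t1 : t <= 1 by rewrite ler_pdivrMr // mul1r; lra.
have Xz : cset X (t *: x + (1 - t) *: y).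
  by have := @cset_convex _ X x y (Itv01 t0 t1); rewrite !inE; exact.
move/eqP: (ns _ Xz); apply; rewrite line_side_conv /t.
by field; rewrite gt_eqF.
Qed.

(** [X] lies strictly on one side of [m], so the part of [C] on the other side is contained in
    [Y]. *)
Lemma stabber_misses_nondecreasing f alpha m C X Y :
  (forall K1 K2 : convexSet R, K1 `<=` K2 -> f K1 <= f K2) ->
  stabber f alpha m C -> C `<=` X `|` Y ->
  (forall t, ~ cset X (line_point m t)) -> alpha <= f Y.
Proof.
move=> mf [aL aR] CXY /convex_misses_line[] XD.
  apply: (le_trans aR); apply: mf => x [Cx /= sx].
  by case: (CXY _ Cx) => // /XD; rewrite ltNge sx.
apply: (le_trans aL); apply: mf => x [Cx /= sx].
by case: (CXY _ Cx) => // /XD; rewrite ltNge sx.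
Qed.

(** [X] lies inside one of the two parts of [C] cut off by [m]. *)
Lemma stabber_misses_nonincreasing f alpha m C X :
  (forall K1 K2 : convexSet R, K1 `<=` K2 -> f K2 <= f K1) ->
  stabber f alpha m C -> X `<=` C ->
  (forall t, ~ cset X (line_point m t)) -> alpha <= f X.
Proof.
move=> mf [aL aR] XC /convex_misses_line[] XD.
  by apply: (le_trans aL); apply: mf => x Xx; split; [exact: XC|exact/ltW/XD].
by apply: (le_trans aR); apply: mf => x Xx; split; [exact: XC|exact/ltW/XD].
Qed.

(** Consider a part of [C] where [f] falls below [alpha]. A stabber [m] has to meet the other part
    if [f] is nondecreasing, and this part if [f] is nonincreasing; otherwise the bound would carry
    over to it. The side thus does not depend on [m]. *)
Lemma not_stabber_side f alpha l C : monotone_cfun f -> ~ stabber f alpha l C ->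
  (forall m, stabber f alpha m C ->
    exists2 t, cset C (line_point m t) & 0 <= line_side l (line_point m t)) \/
  (forall m, stabber f alpha m C ->
    exists2 t, cset C (line_point m t) & line_side l (line_point m t) <= 0).
Proof.
have CLR : C `<=` left_part l C `|` right_part l C.
  by move=> x Cx; have [sx|/ltW sx] := leP 0 (line_side l x); [left|right].
have CRL : C `<=` right_part l C `|` left_part l C by rewrite setUC.
have LC : left_part l C `<=` C by move=> x [].
have RC : right_part l C `<=` C by move=> x [].
case=> mf /not_andP[] na; [right|left|left|right] => m sm;
  apply: contrapT => nt; apply: na.
- apply: (stabber_misses_nondecreasing mf sm CRL) => t [Ct st].
  by apply: nt; exists t.
- apply: (stabber_misses_nondecreasing mf sm CLR) => t [Ct st].
  by apply: nt; exists t.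
- apply: (stabber_misses_nonincreasing mf sm LC) => t [Ct st].
  by apply: nt; exists t.
- apply: (stabber_misses_nonincreasing mf sm RC) => t [Ct st].
  by apply: nt; exists t.
Qed.

(** Equal sets may carry different convexity proofs; monotonicity makes the values agree all the
    same. *)
Lemma monotone_cfun_ext f X Y : monotone_cfun f -> X `<=>` Y -> f X = f Y.
Proof.
by case=> mf [XY YX]; apply/eqP; rewrite eq_le !mf.
Qed.

(** The lines coincide up to direction; for [k < 0] the two parts trade places, and stabbing is
    symmetric in them. *)
Lemma stabber_scale_side f alpha l m C (k : R) : monotone_cfun f -> k != 0 ->
  (forall x, line_side m x = k * line_side l x) ->
  stabber f alpha m C -> stabber f alpha l C.
Proof.
move=> mf k0 mE [aL aR]; have [kn|kp|/eqP] := ltgtP k 0; last by rewrite (negPf k0).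
- have LR : f (left_part m C) = f (right_part l C).
    apply: monotone_cfun_ext => //; split=> x [Cx] /=;
    by rewrite mE => sx; split=> //=; rewrite ?mE; move: sx; rewrite nmulr_rge0.
  have RL : f (right_part m C) = f (left_part l C).
    apply: monotone_cfun_ext => //; split=> x [Cx] /=;
    by rewrite mE => sx; split=> //=; rewrite ?mE; move: sx; rewrite nmulr_rle0.
  by rewrite /stabber -LR -RL.
- have LL : f (left_part m C) = f (left_part l C).
    apply: monotone_cfun_ext => //; split=> x [Cx] /=;
    by rewrite mE => sx; split=> //=; rewrite ?mE; move: sx; rewrite pmulr_rge0.
  have RR : f (right_part m C) = f (right_part l C).
    apply: monotone_cfun_ext => //; split=> x [Cx] /=;
    by rewrite mE => sx; split=> //=; rewrite ?mE; move: sx; rewrite pmulr_rle0.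
  by rewrite /stabber -LL -RR.
Qed.

(** * Lines given by direction angle and offset *)

Definition polar_dir (a : R) : 'rV[R]_2 :=
  \row_k (if k == 0 then cos a else sin a).

Lemma polar_dir_neq0 a : polar_dir a != 0.
Proof.
apply/eqP => /rowP d0; have := cos2Dsin2 a.
have := d0 0; have := d0 1; rewrite !mxE /= => -> ->.
by rewrite expr0n addr0 => /esym/eqP; rewrite oner_eq0.
Qed.

(** The base point is [s] times the left unit normal, so a growing [s] moves the line to its
    left. *)
Definition polar_line (a s : R) : directed_line R :=
  DirectedLine (s *: \row_k (if k == 0 then - sin a else cos a))
               (polar_dir_neq0 a).

Lemma polar_line_side a s x :
  line_side (polar_line a s) x = cos a * x 0 1 - sin a * x 0 0 - s.
Proof.
rewrite /line_side /= !mxE /= -[s in RHS]mulr1 -(cos2Dsin2 a); ring.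
Qed.

(** The rate of change along [m] of the side function of a line at angle [a]; it vanishes exactly
    for parallels. *)
Definition slope a m := cos a * line_dir m 0 1 - sin a * line_dir m 0 0.

Lemma polar_line_side_point a s m t :
  line_side (polar_line a s) (line_point m t) =
  line_side (polar_line a s) (line_base m) + t * slope a m.
Proof. by rewrite !polar_line_side /line_point /slope !mxE; ring. Qed.

Lemma stabber_polar_line f alpha a s m C t : monotone_cfun f ->
  slope a m = 0 -> line_side (polar_line a s) (line_point m t) = 0 ->
  stabber f alpha m C -> stabber f alpha (polar_line a s) C.
Proof.
move=> mf k0; rewrite polar_line_side_point k0 mulr0 addr0 => b0.
(* With zero slope, the direction of [m] is [k] times the unit vector at angle [a]. *)
pose k := line_dir m 0 0 * cos a + line_dir m 0 1 * sin a.
have d0E : line_dir m 0 0 = k * cos a.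
  rewrite -[LHS]mulr1 -(cos2Dsin2 a); apply/eqP; rewrite -subr_eq0; apply/eqP.
  transitivity (- sin a * slope a m); last by rewrite k0 mulr0.
  by rewrite /k /slope; ring.
have d1E : line_dir m 0 1 = k * sin a.
  rewrite -[LHS]mulr1 -(cos2Dsin2 a); apply/eqP; rewrite -subr_eq0; apply/eqP.
  transitivity (cos a * slope a m); last by rewrite k0 mulr0.
  by rewrite /k /slope; ring.
apply: (@stabber_scale_side _ _ _ _ _ k) => //.
  apply/eqP => k00; have := sqr_dir_gt0 m.
  by rewrite d0E d1E k00 !mul0r expr0n addr0 ltxx.
move=> x; rewrite -[line_side _ x in RHS]subr0 -[X in _ * (_ - X)]b0 !polar_line_side.
by rewrite /line_side d0E d1E !mxE; ring.
Qed.

Lemma continuous_polar_line_side s x :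
  continuous (fun a => line_side (polar_line a s) x).
Proof.
have -> : (fun a => line_side (polar_line a s) x) =
    fun a => cos a * x 0 1 - sin a * x 0 0 - s.
  by apply/funext => a; rewrite polar_line_side.
move=> a; apply: cvgB; last exact: cvg_cst.
by apply: cvgB; (apply: cvgM; [|exact: cvg_cst]);
  [exact: continuous_cos|exact: continuous_sin].
Qed.

Lemma continuous_slope m : continuous (slope ^~ m).
Proof.
move=> a; apply: cvgB; (apply: cvgM; [|exact: cvg_cst]);
  [exact: continuous_cos|exact: continuous_sin].
Qed.

(** Otherwise [A] would be clopen and nonempty in the connected real line, leaving no room for
    [B]. *)
Lemma open_cover_overlap (A B : set R) : open A -> open B ->
  A !=set0 -> B !=set0 -> A `|` B = setT -> exists t, A t /\ B t.
Proof.
move=> oA oB A0 [b Bb] AB; apply: contrapT => nAB.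
have AE : A = ~` B.
  apply/seteqP; split=> [x Ax Bx|x nBx]; first by apply: nAB; exists x.
  have : (A `|` B) x by rewrite AB.
  by case.
have /connected_intervalP/(_ A A0) : is_interval [set: R] by [].
move=> cR; suff AT : A = setT by have := Bb; have : A b by [rewrite AT]; rewrite AE.
apply: cR; first by exists A => //; rewrite setTI.
by exists A; rewrite ?setTI // AE; exact: open_closedC.
Qed.

End plane.

(** * Order of the indices in a sweep of fixed direction *)

Section sweep.
Variables (R : realType) (n : nat) (col : 'I_n -> color).
Variables P N : R -> 'I_n -> Prop.
Hypothesis P_down : forall s s' i, s' <= s -> P s i -> P s' i.
Hypothesis N_up : forall s s' i, s <= s' -> N s i -> N s' i.
Hypothesis noPNP : forall s (i j k : 'I_n), (i < j)%N -> (j < k)%N ->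
  col i <> col j -> col j <> col k -> col i <> col k ->
  P s i -> N s j -> P s k -> False.
Hypothesis noNPN : forall s (i j k : 'I_n), (i < j)%N -> (j < k)%N ->
  col i <> col j -> col j <> col k -> col i <> col k ->
  N s i -> P s j -> N s k -> False.

(* P s x (resp. N s x) says that x is to the left (resp. right) of the line of
   offset s in a fixed direction. A switch has, for each color, an index i still
   on the left and an index j already on the right at offset s. *)
Definition switch (i j : color -> 'I_n) (s : color -> R) :=
  forall c, [/\ col (i c) = c, col (j c) = c, P (s c) (i c) & N (s c) (j c)].

(** At every offset from [s a] to [s b], [j a] is on the right and [i b] on the left, so the
    forbidden patterns constrain their order. *)
Definition ascending (i j : color -> 'I_n) (s : color -> R) :=
  forall a b, a <> b -> s a <= s b -> (j a < i b)%N.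

Definition descending (i j : color -> 'I_n) (s : color -> R) :=
  forall a b, a <> b -> s a <= s b -> (i b < j a)%N.

(** The comparison of [j a] with [i b] survives the exchange of one color for the third while the
    offsets stay in order; sorting the colors by offset links all pairs. *)
Lemma switch_type i j s : switch i j s ->
  ascending i j s \/ descending i j s.
Proof.
move=> D.
have E a b : a <> b -> (j a : nat) <> i b.
  move=> ab /val_inj ji; have [_ ca _ _] := D a; have [cb _ _ _] := D b.
  by apply: ab; rewrite -ca ji.
(* At offset [s a] both [i b] and [i c] are on the left, so [j a] cannot lie between them. *)
have F a b c : a <> b -> a <> c -> b <> c -> s a <= s b -> s a <= s c ->
    (j a < i b)%N = (j a < i c)%N.
  move=> ab ac bc sab sac; have [_ ca _ Na] := D a.
  have := E _ _ ab; have := E _ _ ac => nac nab.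
  have PNP y z : [/\ a <> y, a <> z, y <> z, s a <= s y & s a <= s z] ->
      ~~ ((i y < j a)%N && (j a < i z)%N).
    move=> [ay az yz say saz]; apply/negP => /andP[lt1 lt2].
    have [cy _ Py _] := D y; have [cz _ Pz _] := D z.
    apply: (noPNP (s := s a) lt1 lt2); rewrite ?ca ?cy ?cz //; try exact: nesym.
    - exact: P_down Py.
    - exact: P_down Pz.
  have h1 : ~~ ((i b < j a)%N && (j a < i c)%N) by apply: PNP; split.
  have h2 : ~~ ((i c < j a)%N && (j a < i b)%N).
    by apply: PNP; split=> //; exact: nesym.
  by lia.
(* Dually, [i a] cannot lie between [j b] and [j c], both on the right at [s a]. *)
have G a b c : a <> b -> a <> c -> b <> c -> s b <= s a -> s c <= s a ->
    (j b < i a)%N = (j c < i a)%N.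
  move=> ab ac bc sba sca; have [ca _ Pa _] := D a.
  have := E _ _ (nesym ab); have := E _ _ (nesym ac) => nca nba.
  have NPN y z : [/\ a <> y, a <> z, y <> z, s y <= s a & s z <= s a] ->
      ~~ ((j y < i a)%N && (i a < j z)%N).
    move=> [ay az yz say saz]; apply/negP => /andP[lt1 lt2].
    have [_ cy _ Ny] := D y; have [_ cz _ Nz] := D z.
    apply: (noNPN (s := s a) lt1 lt2); rewrite ?ca ?cy ?cz //; try exact: nesym.
    - exact: N_up Ny.
    - exact: N_up Nz.
  have h1 : ~~ ((j b < i a)%N && (i a < j c)%N) by apply: NPN; split.
  have h2 : ~~ ((j c < i a)%N && (i a < j b)%N).
    by apply: NPN; split=> //; exact: nesym.
  by lia.
have [a [b [c [ab bc ac sab sbc]]]] :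
    exists a b c, [/\ a <> b, b <> c, a <> c, s a <= s b & s b <= s c].
  have [rg|/ltW gr] := leP (s red) (s green);
  have [gb|/ltW bg] := leP (s green) (s blue);
  have [rb|/ltW br] := leP (s red) (s blue).
  - by exists red, green, blue.
  - by exists red, green, blue.
  - by exists red, blue, green.
  - by exists blue, red, green.
  - by exists green, red, blue.
  - by exists green, blue, red.
  - by exists blue, green, red.
  - by exists blue, green, red.
have sac := le_trans sab sbc.
have abc x : [\/ x = a, x = b | x = c].
  move: x a b c ab bc ac {sab sbc sac} => [] [] [] [] // *;
    by [apply: Or31|apply: Or32|apply: Or33].
have rac x y : x <> y -> s x <= s y -> (j x < i y)%N = (j a < i c)%N.
  have rab : (j a < i b)%N = (j a < i c)%N by exact: F.
  have rbc : (j b < i c)%N = (j a < i c)%N by apply: G => //; exact: nesym.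
  (* The remaining pairs run against the sorted order, so their offsets tie. *)
  case: (abc x) (abc y) => -> [] -> // xy sxy.
  - by rewrite (F b a c) //; exact: nesym.
  - rewrite (G a c b) //; [|exact: nesym|exact: le_trans sbc sxy].
    by rewrite (F b a c) //; [exact: nesym|exact: le_trans sbc sxy].
  - by rewrite (G b c a) //; exact: nesym.
case rE: (j a < i c)%N; [left|right] => x y xy sxy; have := rac x y xy sxy.
  by rewrite rE.
have := E _ _ xy; lia.
Qed.

Definition mix T (x y : color -> T) (w : color -> bool) c :=
  if w c then x c else y c.

Lemma switch_mix i j s i' j' s' w : switch i j s -> switch i' j' s' ->
  switch (mix i i' w) (mix j j' w) (mix s s' w).
Proof. by move=> D D' c; rewrite /mix; case: (w c). Qed.

(* The type of a switch can be read off any two of the colors, so it is not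
   affected by a change at the third one. *)
Lemma ascending_change i j s i' j' s' a b : a <> b ->
  switch i' j' s' -> ascending i j s ->
  [/\ i a = i' a, j a = j' a & s a = s' a] ->
  [/\ i b = i' b, j b = j' b & s b = s' b] -> ascending i' j' s'.
Proof.
move=> ab /switch_type[//|D'] D [ia ja sa] [ib jb sb].
case: (leP (s a) (s b)) => [|/ltW] sab.
  have := D _ _ ab sab; rewrite ja ib => lt.
  by have := D' a b ab; rewrite -sa -sb => /(_ sab); lia.
have ba := nesym ab; have := D _ _ ba sab; rewrite jb ia => lt.
by have := D' b a ba; rewrite -sa -sb => /(_ sab); lia.
Qed.

(** One switch is turned into the other a color at a time: red, green, blue. Each change leaves two
    colors fixed. *)
Lemma ascending_unique i j s i' j' s' : switch i j s -> switch i' j' s' ->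
  ascending i j s -> ascending i' j' s'.
Proof.
move=> D D' A.
pose w1 c := if c is red then false else true.
pose w2 c := if c is blue then true else false.
have A1 : ascending (mix i i' w1) (mix j j' w1) (mix s s' w1).
  exact: (@ascending_change i j s _ _ _ green blue _ (switch_mix _ D D')).
have A2 : ascending (mix i i' w2) (mix j j' w2) (mix s s' w2).
  exact: (@ascending_change _ _ _ _ _ _ red blue _ (switch_mix _ D D') A1).
exact: (@ascending_change _ _ _ _ _ _ red green _ D' A2).
Qed.

Lemma ascending_descending i j s : ascending i j s -> descending i j s -> False.
Proof.
move=> A D; have rg : red <> green by []; have gr := nesym rg.
have [sle|/ltW sle] := leP (s red) (s green).
  by have := A _ _ rg sle; have := D _ _ rg sle; lia.
by have := A _ _ gr sle; have := D _ _ gr sle; lia.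
Qed.

End sweep.

(** * Signs of the sets and rotation of the sweep *)

Section signs.
Variables (R : realType) (n : nat) (col : 'I_n -> color).
Variables (C : 'I_n -> convexSet R) (f : 'I_n -> convexSet R -> R).
Variable alpha : 'I_n -> R.

Let triple : finType := ('I_n * 'I_n * 'I_n)%type.

Definition rainbow_triple (r : triple) := let: (i, j, k) := r in
  [/\ (i < j)%N, (j < k)%N, col i <> col j, col j <> col k & col i <> col k].

Definition in_triple x (r : triple) := let: (i, j, k) := r in
  [set i; j; k] x.

Variables (m : triple -> directed_line R) (d : triple -> R).

Hypothesis f_monotone : forall x, monotone_cfun (f x).
Hypothesis d_gt0 : forall r, rainbow_triple r -> 0 < d r.
Hypothesis m_stabber : forall r x, rainbow_triple r -> in_triple x r ->
  stabber (f x) (alpha x) (m r) (C x).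
Hypothesis m_meets : forall r x, rainbow_triple r -> in_triple x r ->
  meets (m r) (C x).
Hypothesis m_gap : forall i j k s t u, rainbow_triple (i, j, k) ->
  cset (C i) (line_point (m (i, j, k)) s) ->
  cset (C j) (line_point (m (i, j, k)) t) ->
  cset (C k) (line_point (m (i, j, k)) u) ->
  s + d (i, j, k) <= t /\ t + d (i, j, k) <= u.

Definition tolerance a r := `|slope a (m r)| * d r / 2.

(* On every chosen transversal through it, C x has a point to the left (e = 1)
   or to the right (e = -1) of the line at angle a and offset s. The tolerance
   makes the condition open; it stays below half of what the side function
   gains across a gap of m r, so no line alternates sides along m r, and it
   vanishes on the parallels to m r, so the condition fails on m r itself. *)
Definition on_side (e a s : R) x := forall r, rainbow_triple r ->
  in_triple x r -> exists2 t, cset (C x) (line_point (m r) t) &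
    - tolerance a r < e * line_side (polar_line a s) (line_point (m r) t).

Lemma on_side_le e a s s' x : e * s' <= e * s ->
  on_side e a s x -> on_side e a s' x.
Proof.
move=> ess S r rr xr; have [t Ct lt] := S r rr xr; exists t => //.
by apply: (lt_le_trans lt); rewrite !polar_line_side; lra.
Qed.

(** This is the same line reversed: the side function and the slope change sign, the tolerance does
    not change. *)
Lemma on_side_pi e a s x : on_side (- e) a s x -> on_side e (a + pi) (- s) x.
Proof.
move=> S r rr xr; have [t Ct lt] := S r rr xr; exists t => //; move: lt.
rewrite /tolerance /slope !polar_line_side cosDpi sinDpi.
by rewrite (_ : - cos a * _ - _ = - slope a (m r)) ?normrN /slope; lra.
Qed.

(** Along the transversal the side function is affine and changes by at least two tolerances across
    each gap. *)
Lemma on_side_alternate e a s i j k : `|e| = 1 -> rainbow_triple (i, j, k) ->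
  on_side e a s i -> on_side (- e) a s j -> on_side e a s k -> False.
Proof.
move=> e1 rr Si Sj Sk.
have [|ti Ci] := Si _ rr; first by left; left.
have [|tj Cj] := Sj _ rr; first by left; right.
have [|tk Ck] := Sk _ rr; first by right.
have [gij gjk] := m_gap rr Ci Cj Ck.
rewrite /tolerance !polar_line_side_point; set l := m _; set dr := d _.
set g := line_side _ _.
pose k' := e * slope a l.
have -> : `|slope a l| = `|k'| by rewrite normrM e1 mul1r.
have gE t : e * (g + t * slope a l) = e * g + k' * t by rewrite /k'; ring.
rewrite !mulNr !gE => hk hj hi.
(* If [e] times the side function does not fall along the transversal, [i] and [j] conflict; if it
   falls, [j] and [k] do. *)
have [k0|k0] := leP 0 k'; move: hi hj hk.
  have : k' * (ti + dr) <= k' * tj by rewrite ler_wpM2l.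
  by rewrite ger0_norm //; lra.
have : k' * tk <= k' * (tj + dr) by rewrite ler_wnM2l // ltW.
by rewrite ltr0_norm //; lra.
Qed.

(** Filters are closed under finite intersections, and there are finitely many triples. *)
Lemma on_side_near (T : Type) (F : set_system T) e (a s : T -> R) x :
  Filter F ->
  (forall r, rainbow_triple r -> in_triple x r ->
    \forall u \near F, exists2 t, cset (C x) (line_point (m r) t) &
      - tolerance (a u) r <
        e * line_side (polar_line (a u) (s u)) (line_point (m r) t)) ->
  \forall u \near F, on_side e (a u) (s u) x.
Proof.
move=> FF S.
pose G r u := rainbow_triple r -> in_triple x r ->
  exists2 t, cset (C x) (line_point (m r) t) & - tolerance (a u) r <
    e * line_side (polar_line (a u) (s u)) (line_point (m r) t).
apply: (@filter_forall _ _ G) => r; rewrite /G.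
have [rr|nr] := pselect (rainbow_triple r); last by apply: filterE.
have [xr|nx] := pselect (in_triple x r); last by apply: filterE.
by apply: filterS (S r rr xr).
Qed.

Lemma on_side_nonempty e a x : `|e| = 1 -> exists s, on_side e a s x.
Proof.
(* A line far out on the side opposite to [e] has one chosen point per triple on its side [e]. *)
move=> e1; suff : \forall M \near +oo, on_side e a (- e * M) x.
  by case/filter_ex => M S; exists (- e * M).
apply: (@on_side_near _ _ e (cst a) (fun M => - e * M)) => r rr xr.
have [t Ct] := m_meets rr xr.
pose h := e * line_side (polar_line a 0) (line_point (m r) t).
have : \forall M \near +oo, - h < M by apply: nbhs_pinfty_gt; rewrite num_real.
apply: filterS => M hM; exists t => //.
have tol0 : 0 <= tolerance a r.
  by rewrite /tolerance divr_ge0 // mulr_ge0 // ltW // d_gt0.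
have ee : e * e = 1 by rewrite -expr2 -real_normK ?num_real // e1 expr1n.
apply: (@le_lt_trans _ _ 0); first by rewrite oppr_le0.
rewrite (_ : e * _ = h + e * e * M); first by rewrite ee; lra.
by rewrite /h !polar_line_side; ring.
Qed.

Lemma on_side_near_offset e a s x : on_side e a s x ->
  \forall s' \near s, on_side e a s' x.
Proof.
move=> S; apply: (@on_side_near _ (nbhs s) e (cst a) id) => r rr xr.
have [t Ct] := S r rr xr; set p := line_point _ _ => lt.
have cv : e * (line_side (polar_line a 0) p - s') @[s' --> s] -->
    e * (line_side (polar_line a 0) p - s).
  by apply: cvgM; [exact: cvg_cst|apply: cvgB; [exact: cvg_cst|exact: cvg_id]].
have sE s' : line_side (polar_line a 0) p - s' = line_side (polar_line a s') p.
  by rewrite !polar_line_side subr0.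
have lt0 : - tolerance a r < e * (line_side (polar_line a 0) p - s).
  by rewrite sE.
by apply: filterS (cvgr_gt _ cv _ lt0) => s'; rewrite sE => lt'; exists t.
Qed.

Lemma on_side_near_angle e a s x : on_side e a s x ->
  \forall a' \near a, on_side e a' s x.
Proof.
move=> S; apply: (@on_side_near _ (nbhs a) e id (cst s)) => r rr xr.
have [t Ct] := S r rr xr; set p := line_point _ _ => lt.
(* The tolerance also varies with the angle; including it makes the condition [0 < F a'] with [F]
   continuous. *)
pose F a' := e * line_side (polar_line a' s) p + tolerance a' r.
have cv : F a' @[a' --> a] --> F a.
  apply: cvgD; first apply: cvgM; first exact: cvg_cst.
    exact: continuous_polar_line_side.
  apply: cvgM; last exact: cvg_cst.
  apply: cvgM; last exact: cvg_cst.
  by apply: cvg_norm; exact: continuous_slope.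
have F0 : 0 < F a by rewrite /F; lra.
by apply: filterS (cvgr_gt _ cv _ F0) => a'; rewrite /F => lt'; exists t => //; rewrite -/p; lra.
Qed.

(** [not_stabber_side] gives a weak inequality, enough if the tolerance is positive. If it is zero,
    [m r] is parallel to the line, and a common point would make them coincide, so that the line
    would stab [C x]. *)
Lemma on_side_cover a s x :
  ~ stabber (f x) (alpha x) (polar_line a s) (C x) ->
  on_side 1 a s x \/ on_side (-1) a s x.
Proof.
move=> nst.
have tol r t : rainbow_triple r -> in_triple x r ->
    tolerance a r = 0 -> line_side (polar_line a s) (line_point (m r) t) != 0.
  move=> rr xr tol0; apply/eqP => l0; apply: nst.
  apply: (stabber_polar_line (f_monotone x) _ l0 (m_stabber rr xr)).
  have := d_gt0 rr; move/eqP: tol0; rewrite /tolerance !mulf_eq0 normr_eq0.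
  by move=> /orP[/orP[/eqP//|/eqP->]|]; [rewrite ltxx|rewrite invr_eq0 pnatr_eq0].
have tol_ge0 r : rainbow_triple r -> 0 <= tolerance a r.
  by move=> rr; rewrite /tolerance divr_ge0 // mulr_ge0 // ltW // d_gt0.
have [] := not_stabber_side (f_monotone x) nst => S; [left|right] => r rr xr;
  have [t Ct st] := S _ (m_stabber rr xr); exists t => //;
  have := tol_ge0 r rr; rewrite le0r => /orP[/eqP tol0|]; try lra;
  rewrite tol0 oppr0 ?mul1r ?mulN1r ?oppr_gt0 lt_neqAle st andbT //.
  by rewrite eq_sym; exact: tol.
exact: tol.
Qed.

Lemma on_side_PNP a s (i j k : 'I_n) : (i < j)%N -> (j < k)%N ->
  col i <> col j -> col j <> col k -> col i <> col k ->
  on_side 1 a s i -> on_side (-1) a s j -> on_side 1 a s k -> False.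
Proof. by move=> *; apply: (@on_side_alternate 1 a s i j k); rewrite ?normr1. Qed.

Lemma on_side_NPN a s (i j k : 'I_n) : (i < j)%N -> (j < k)%N ->
  col i <> col j -> col j <> col k -> col i <> col k ->
  on_side (-1) a s i -> on_side 1 a s j -> on_side (-1) a s k -> False.
Proof.
move=> *; apply: (@on_side_alternate (-1) a s i j k);
  by rewrite ?normrN1 ?opprK.
Qed.

Definition side_switch a := switch col (on_side 1 a) (on_side (-1) a).

Lemma side_switch_pi a i j s :
  side_switch a i j s -> side_switch (a + pi) j i (\- s).
Proof.
move=> D c; have [ci cj Pi Nj] := D c; split=> //; apply: on_side_pi => //.
by rewrite opprK.
Qed.

Lemma side_switch_near a i j s : side_switch a i j s ->
  \forall a' \near a, side_switch a' i j s.
Proof.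
move=> D.
have near1 c : \forall a' \near a, [/\ col (i c) = c, col (j c) = c,
    on_side 1 a' (s c) (i c) & on_side (-1) a' (s c) (j c)].
  have [ci cj /on_side_near_angle Pi /on_side_near_angle Nj] := D c.
  by apply: filterS2 Pi Nj => a' *; split.
apply: filterS (filterI (near1 red) (filterI (near1 green) (near1 blue))).
by move=> a' [? [? ?]] [].
Qed.

(** For each color, the offsets with some index on the left and those with some index on the right
    form nonempty open sets covering the real line; [s c] is taken in their overlap. *)
Lemma side_switch_exists a :
  (forall c s, exists2 x, col x = c &
    ~ stabber (f x) (alpha x) (polar_line a s) (C x)) ->
  exists i j s, side_switch a i j s.
Proof.
move=> nst.
have /choice[F FP] c : exists q : 'I_n * 'I_n * R, [/\ col q.1.1 = c,
    col q.1.2 = c, on_side 1 a q.2 q.1.1 & on_side (-1) a q.2 q.1.2].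
  pose A e := [set s | exists2 x, col x = c & on_side e a s x].
  have A0 e : `|e| = 1 -> A e !=set0.
    move=> e1; have [x cx _] := nst c 0.
    by have [s S] := on_side_nonempty a x e1; exists s, x.
  have oA e : open (A e).
    rewrite openE => s [x cx /on_side_near_offset S].
    by apply: filterS S => s' S; exists x.
  have [|||||s [[x cx S] [y cy S']]] := @open_cover_overlap _ (A 1) (A (-1)).
  - exact: oA.
  - exact: oA.
  - by apply: A0; rewrite normr1.
  - by apply: A0; rewrite normrN1.
  - apply/seteqP; split=> // s _; have [x cx /on_side_cover[]] := nst c s.
      by left; exists x.
    by right; exists x.
  by exists (x, y, s).
exists (fun c => (F c).1.1), (fun c => (F c).1.2), (fun c => (F c).2).
exact: FP.
Qed.

Lemma polar_transversal : exists c a s,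
  transversal f alpha (polar_line a s) C [set x | col x = c].
Proof.
apply: contrapT => nex.
have sw a : exists i j s, side_switch a i j s.
  apply: side_switch_exists => c s; apply: contrapT => nx; apply: nex.
  exists c, a, s => x cx; apply: contrapT => nst; apply: nx.
  by exists x.
have down a s s' x : s' <= s -> on_side 1 a s x -> on_side 1 a s' x.
  by move=> ss; apply: on_side_le; rewrite !mul1r.
have up a s s' x : s <= s' -> on_side (-1) a s x -> on_side (-1) a s' x.
  by move=> ss; apply: on_side_le; rewrite !mulN1r lerN2.
have type a i j s : side_switch a i j s ->
    ascending i j s \/ descending i j s.
  exact: (switch_type (down a) (up a) (@on_side_PNP a) (@on_side_NPN a)).
pose A := [set a | exists i j s, side_switch a i j s /\ ascending i j s].
pose B := [set a | exists i j s, side_switch a i j s /\ descending i j s].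
have oA : open A.
  rewrite openE => a [i [j [s [/side_switch_near D As]]]].
  by apply: filterS D => a' D; exists i, j, s.
have oB : open B.
  rewrite openE => a [i [j [s [/side_switch_near D Ds]]]].
  by apply: filterS D => a' D; exists i, j, s.
have AB : A `|` B = setT.
  apply/seteqP; split=> // a _; have [i [j [s D]]] := sw a.
  by have [T|T] := type _ _ _ _ D; [left|right]; exists i, j, s.
have [i [j [s D]]] := sw 0; have Dpi := side_switch_pi D.
(* Reversal negates the offsets and swaps [i] with [j], so it exchanges the two types. *)
have [A0 B0] : A !=set0 /\ B !=set0.
  have [T|T] := type _ _ _ _ D.
    split; first by exists 0, i, j, s.
    exists (0 + pi), j, i, (\- s); split=> // b c bc /=; rewrite lerN2.
    by apply: T; exact: nesym.
  split; last by exists 0, i, j, s.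
  exists (0 + pi), j, i, (\- s); split=> // b c bc /=; rewrite lerN2.
  by apply: T; exact: nesym.
have [a [[i1 [j1 [s1 [D1 A1]]]] [i2 [j2 [s2 [D2 A2]]]]]] :=
  open_cover_overlap oA oB A0 B0 AB.
(* At the common angle, uniqueness makes the descending switch ascending as well. *)
apply: ascending_descending A2.
by apply: (ascending_unique (down a) (up a) (@on_side_PNP a) (@on_side_NPN a) D1 D2).
Qed.

End signs.

Theorem theorem1p2 (R : realType) (n : nat) (C : 'I_n -> convexSet R)
    (col : 'I_n -> color)
    (f : 'I_n -> convexSet R -> R) (alpha : 'I_n -> R)
    (C_compact : forall i, compact (C i : set 'rV[R]_2))
    (C_disjoint : forall i j, i <> j ->
      (C i : set 'rV[R]_2) `&` (C j : set 'rV[R]_2) = set0)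
    (f_monotone : forall i, monotone_cfun (f i))
    (f_continuous : forall i, hausdorff_continuous (f i))
    (rainbow : forall i j k : 'I_n, (i < j)%N -> (j < k)%N ->
      col i <> col j -> col j <> col k -> col i <> col k ->
      exists l : directed_line R,
        transversal f alpha l C [set i; j; k] /\
        meets_in_order l (C i) (C j) (C k)) :
  exists (c : color) (l : directed_line R),
    transversal f alpha l C [set i | col i = c].
Proof.
have /choice[F FP] (r : 'I_n * 'I_n * 'I_n) : exists q : directed_line R * R,
    rainbow_triple col r -> [/\ 0 < q.2,
      forall x, in_triple x r -> stabber (f x) (alpha x) q.1 (C x),
      forall x, in_triple x r -> meets q.1 (C x) &
      forall s t u, cset (C r.1.1) (line_point q.1 s) ->
        cset (C r.1.2) (line_point q.1 t) -> cset (C r.2) (line_point q.1 u) ->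
        s + q.2 <= t /\ t + q.2 <= u].
  have [rr|nr] := pselect (rainbow_triple col r); last first.
    by exists (polar_line 0 0, 0).
  case: r rr => -[i j] k [ij jk cij cjk cik].
  have [l [lT [mi mj mk pij pjk]]] := rainbow i j k ij jk cij cjk cik.
  have [d1 d1_gt0 gij] := precedes_gap (C_compact i) (C_compact j) mi mj pij.
  have [d2 d2_gt0 gjk] := precedes_gap (C_compact j) (C_compact k) mj mk pjk.
  (* The smaller gap serves both consecutive pairs. *)
  exists (l, Num.min d1 d2) => _; split=> /=.
  - by rewrite lt_min d1_gt0.
  - by move=> x xr; exact: lT.
  - by move=> x [[->|->]|->].
  move=> s t u Cs Ct Cu; have := gij _ _ Cs Ct; have := gjk _ _ Ct Cu.
  have : Num.min d1 d2 <= d1 by rewrite ge_min lexx.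
  have : Num.min d1 d2 <= d2 by rewrite ge_min lexx orbT.
  by split; lra.
have [||||c [a [s T]]] := @polar_transversal R n col C f alpha
  (fun r => (F r).1) (fun r => (F r).2) f_monotone.
- by move=> r /FP[].
- by move=> r x /FP[_ st _ _]; exact: st.
- by move=> r x /FP[_ _ mt _]; exact: mt.
- by move=> i j k s t u /FP[_ _ _ gap]; exact: gap.
by exists c, (polar_line a s).
Qed.
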